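(* Let $P \subset \mathbb{R}^d$ be a convex polytope that $k$-tiles $\mathbb{R}^d$ with a discrete multiset $\Lambda$. If every element of $\Lambda$ is contained in a union of two translated copies of one single lattice in $\mathbb{R}^d$, then there is a lattice $\mathcal{L}$ in $\mathbb{R}^d$ such that $P$ $m$-tiles $\mathbb{R}^d$ with $\mathcal{L}$ for some positive integer $m$.
   Context: A lattice in $\mathbb{R}^d$ is the set of integer linear combinations of a basis of $\mathbb{R}^d$; a translated copy of a lattice $\mathcal{M}$ is a set $a + \mathcal{M}$ with $a \in \mathbb{R}^d$. $\partial P$ denotes the boundary of $P$ (closure minus interior), and $A + B = \{a+b : a \in A, b \in B\}$. For a positive integer $k$, a convex polytope $P \subset \mathbb{R}^d$ $k$-tiles $\mathbb{R}^d$ with a discrete multiset $\Lambda$ of vectors in $\mathbb{R}^d$ if $\sum_{\lambda \in \Lambda} \mathbf{1}_{P+\lambda}(v) = k$ for all $v \in \mathbb{R}^d$ with $v \notin \partial P + \Lambda$ (the sum counts multiplicities; $\mathbf{1}_X$ is the indicator function of $X$). A set is regarded as a multiset with all multiplicities $1$. *)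

(* Defs.v *)
From mathcomp Require Import all_boot all_order all_algebra.
From mathcomp Require Import all_classical all_reals all_analysis.
Import Order.TTheory GRing.Theory Num.Theory.
Import numFieldNormedType.Exports.

Set Implicit Arguments.
Unset Strict Implicit.
Unset Printing Implicit Defensive.

Local Open Scope classical_set_scope.
Local Open Scope ring_scope.

Definition minkowski_sum {V : zmodType} (A B : set V) : set V :=
  [set a + b | a in A & b in B].

Definition translate {V : zmodType} (A : set V) (t : V) : set V :=
  [set a + t | a in A].

Definition boundary {T : topologicalType} (A : set T) : set T :=
  closure A `\` interior A.

(* Full dimension is not required: a set with empty interior never tiles. *)
Definition convex_polytope {R : realType} {d : nat} (P : set 'rV[R]_d) : Prop :=
  exists (n : nat) (p : 'I_n -> 'rV[R]_d),
    P = [set \sum_i w i *: p i |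
           w in [set w : 'I_n -> R | (forall i, 0 <= w i) /\ \sum_i w i = 1]].

(* The rows of the invertible matrix B are the basis. *)
Definition lattice {R : realType} {d : nat} (L : set 'rV[R]_d) : Prop :=
  exists2 B : 'M[R]_d, B \in unitmx
    & L = [set map_mx intr z *m B | z in [set: 'rV[int]_d]].

(* A multiset is given by its multiplicity function. *)
Definition multiset (T : Type) : Type := T -> nat.

Definition multiset_support {T : Type} (Lam : multiset T) : set T :=
  [set x | (0 < Lam x)%N].

Definition multiset_of_set {T : Type} (A : set T) : multiset T :=
  fun x => (x \in A : nat).

Definition discrete_multiset {T : topologicalType} (Lam : multiset T) : Prop :=
  multiset_support Lam `<=` isolated (multiset_support Lam).

(* The sum is the extended-real sum over all vectors l; the terms with l
   outside the support vanish, and the sum is +oo when it diverges. *)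
Definition k_tiles {R : realType} {d : nat} (k : nat) (P : set 'rV[R]_d)
    (Lam : multiset 'rV[R]_d) : Prop :=
  forall v : 'rV[R]_d,
    ~ minkowski_sum (boundary P) (multiset_support Lam) v ->
    \esum_(l in [set: 'rV[R]_d]) ((Lam l)%:R * \1_(translate P l) v)%:E
      = (k%:R%:E : \bar R).

(* Main.v *)
Require Import Defs.
From mathcomp Require Import finmap.
From HB Require Import structures.
From mathcomp Require Import all_boot all_order all_algebra.
From mathcomp Require Import all_classical all_reals all_analysis.
From mathcomp Require Import zify ring lra.
Import Order.TTheory GRing.Theory Num.Theory.
Import numFieldNormedType.Exports.

(** Write [M] for the lattice and [f v] for the number of points [m] of [M] with
    [v - m] in [P].  Averaging the tiling identity over large boxes of [M]
    replaces the multiset by two constant weights: [al * f v + be * f (v + t) = k]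
    for generic [v], with [t = a - b].  If [al] and [be] differ, the integrality
    of [f] forces it to be constant.  If they are equal, [f v + f (v + t) = c], so
    [t + t] is a period of [f].  The periods form a closed subgroup of R^d
    containing [M], hence [t] can be corrected by a line of periods into a vector
    [s] such that [s *+ n] lies in [M] for some [n > 0] and still
    [f v + f (v + s) = c].  Then [P] tiles with [M / n]: the cosets of [M] in
    [M / n] are paired by [s], each pair contributing [c]. *)

Set Implicit Arguments.
Unset Strict Implicit.
Unset Printing Implicit Defensive.
Local Open Scope classical_set_scope.
Local Open Scope ring_scope.

(** * Matrix norms and compactness of polytopes *)

Section Matrices.
Context {R : realType}.

Lemma le_mx_entry m n (A : 'M[R]_(m, n)) i j : `|A i j| <= `|A|.
Proof. by rewrite [leRHS]mx_normrE; apply: (le_bigmax _ _ (i, j)). Qed.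

Lemma mx_norm_le m n (A : 'M[R]_(m, n)) (c : R) :
  0 <= c -> (forall i j, `|A i j| <= c) -> `|A| <= c.
Proof.
by move=> c0 Ac; rewrite [leLHS]mx_normrE; apply: bigmax_le => // -[i j] _; exact: Ac.
Qed.

(** The norm is the largest absolute value of an entry, and an entry of the product has [n] terms;
    hence the factor [n%:R]. *)
Lemma mx_norm_mulmx_le m n p (A : 'M[R]_(m, n)) (B : 'M[R]_(n, p)) :
  `|A *m B| <= n%:R * (`|A| * `|B|).
Proof.
apply: mx_norm_le => [|i j]; first by rewrite !mulr_ge0.
rewrite mxE (le_trans (ler_norm_sum _ _ _))//.
have -> : n%:R * (`|A| * `|B|) = \sum_(l < n) `|A| * `|B|.
  by rewrite sumr_const card_ord mulr_natl.
by apply: ler_sum => l _; rewrite normrM ler_pM ?le_mx_entry.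
Qed.

Lemma mulmxr_continuous n p (B : 'M[R]_(n, p)) :
  continuous (fun x : 'rV[R]_n => x *m B).
Proof.
move=> x; apply/(@cvgrPdist_lt _ _ _ (nbhs x) (nbhs_filter x)) => e e0.
(* The [+ 1] keeps the divisor of [e] positive even when [B] is zero. *)
have c0 : 0 < n%:R * `|B| + 1 :> R by rewrite ltr_wpDl// mulr_ge0.
near=> y.
rewrite -mulmxBl (le_lt_trans (mx_norm_mulmx_le _ _))//.
rewrite mulrCA mulrC.
have : `|x - y| < e / (n%:R * `|B| + 1).
  by near: y; apply: cvgr_dist_lt => //; rewrite divr_gt0.
rewrite ltr_pdivlMr//; apply: le_lt_trans.
by rewrite mulrC ler_wpM2l// lerDl.
Unshelve. all: by end_near. Qed.

(** A polytope is the linear image of a standard simplex, and the simplex is a hyperplane section of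
    the unit cube. *)
Lemma convex_polytope_compact d (P : set 'rV[R]_d) :
  convex_polytope P -> compact P.
Proof.
move=> [n [p ->]].
pose S := [set w : 'rV[R]_n | (forall i, 0 <= w 0 i) /\ \sum_i w 0 i = 1].
have -> : [set \sum_i w i *: p i | w in
   [set w : 'I_n -> R | (forall i, 0 <= w i) /\ \sum_i w i = 1]] =
   (fun w : 'rV[R]_n => w *m \matrix_i p i) @` S.
  apply/seteqP; split => [_ [w [w0 w1] <-]|_ [w [w0 w1] <-]] /=.
    exists (\row_i w i).
      split=> [i|]; first by rewrite mxE.
      by rewrite -[RHS]w1; apply: eq_bigr => i _; rewrite mxE.
    by rewrite mulmx_sum_row; apply: eq_bigr => i _; rewrite rowK mxE.
  exists (fun i => w 0 i) => //.
  by rewrite mulmx_sum_row; apply: eq_bigr => i _; rewrite rowK.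
apply: continuous_compact; first exact/continuous_subspaceT/mulmxr_continuous.
pose S1 := [set w : 'rV[R]_n | forall i, `[0, 1]%classic (w ord0 i)].
pose S2 := (fun w : 'rV[R]_n => w *m const_mx 1) @^-1` [set (1 : 'rV[R]_1)].
have -> : S = S1 `&` S2.
  have sE (w : 'rV[R]_n) : w *m const_mx 1 = (\sum_i w 0 i)%:M :> 'rV[R]_1.
    apply/rowP => i; rewrite !mxE ord1 eqxx mulr1n.
    by apply: eq_bigr => j _; rewrite mxE mulr1.
  apply/seteqP; split => w [w0 w1]; split => //.
  - move=> i; rewrite /= in_itv/= w0/= -w1 (bigD1 i)//= lerDl.
    by apply: sumr_ge0 => j _.
  - by rewrite /S2/= sE w1.
  - by move=> i; have := w0 i; rewrite /= in_itv/= => /andP[].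
  - by move: w1; rewrite /S2/= sE => /(congr1 (fun A : 'rV_1 => A 0 0)); rewrite !mxE eqxx.
apply: compact_closedI.
  by apply: (@rV_compact R _ (fun=> `[0, 1]%classic)) => i; exact: segment_compact.
apply: preimage_closed; last first.
  exact/accessible_closed_set1/hausdorff_accessible/norm_hausdorff.
by move=> w _; apply: mulmxr_continuous.
Qed.

End Matrices.

(** * Functions locally constant off a closed nowhere dense set *)

Definition locally_constant_off {V : topologicalType} {T : Type}
    (E : set V) (f : V -> T) : Prop :=
  [/\ open (~` E), dense (~` E) & forall v, ~ E v -> \forall w \near v, f w = f v].

(** With [phi := id] the vector [s] is a period of [f]; with [phi x := c - x] it exchanges
    complementary values. Only generic pairs are tested, since nothing is known of [f] on [E]. *)
Definition shift_acts {V : zmodType} {T : Type} (E : set V) (f : V -> T)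
    (phi : T -> T) (s : V) : Prop :=
  forall v, ~ E v -> ~ E (v + s) -> f (v + s) = phi (f v).

Section ShiftActs.
Context {R : realType} {V : normedModType R} {T : Type}.
Variables (E : set V) (f : V -> T).
Hypothesis fE : locally_constant_off E f.

Lemma near_shift (v s : V) (Q : set V) : nbhs (v + s) Q -> \forall w \near v, Q (w + s).
Proof.
move=> Qvs.
have : (w + s) @[w --> v] --> v + s by apply: cvgD; [exact: cvg_id | exact: cvg_cst].
exact.
Qed.

Lemma open_shift (s : V) (U : set V) : open U -> open [set v | U (v + s)].
Proof. by rewrite !openE => oU v Uv; apply: near_shift; exact: oU. Qed.

(** Density of the complement of [E] allows a small move of [v] after which its translate by [s] is
    generic too. *)
Lemma near_shift_generic (v s : V) (Q : set V) :
  (\forall w \near v, Q w) -> exists2 w, Q w & ~ E (w + s).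
Proof.
move=> Qv; have [_ dE _] := fE.
have : nbhs (v + s) [set w | Q (w - s)] by apply: near_shift; rewrite addrK.
rewrite nbhsE => -[U [oU Uv] UQ].
have [|w [Uw Ew]] := dE U _ oU; first by exists (v + s).
by exists (w - s); [exact: UQ | rewrite subrK].
Qed.

Lemma near_generic v : ~ E v -> \forall w \near v, ~ E w.
Proof.
by have [oE _ _] := fE => Ev; have : nbhs v (~` E) by apply: open_nbhs_nbhs; split.
Qed.

Lemma near_generic_shift v s : ~ E (v + s) ->
  \forall w \near v, ~ E (w + s) /\ f (w + s) = f (v + s).
Proof.
move=> Evs; have [_ _ lf] := fE.
apply: (@near_shift v s [set w | ~ E w /\ f w = f (v + s)]).
by apply: filterI; [exact: near_generic | exact: lf].
Qed.

(** The intermediate point [v + s] may lie in [E]; moving [v] slightly avoids this without changing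
    the values of [f] at the two ends. *)
Lemma shift_acts_comp (phi psi : T -> T) s t :
  shift_acts E f phi s -> shift_acts E f psi t ->
  shift_acts E f (psi \o phi) (s + t).
Proof.
move=> fs ft v Ev Evst; have [_ _ lf] := fE.
have [w [[Ew fw] [Ewst <-]] Ews] := near_shift_generic s (filterI
  (filterI (near_generic Ev) (lf _ Ev)) (near_generic_shift Evst)).
by rewrite addrA ft -?addrA// fs//= fw.
Qed.

(** An admissible [t] within [r / 2] of [s] and a point [w] within [r / 2] of [v] keep [w + t] in
    the ball around [v + s] on which [f] is constant. *)
Lemma shift_acts_closed (phi : T -> T) : closed (shift_acts E f phi).
Proof.
move=> s cs v Ev Evs; have [_ _ lf] := fE.
have /nbhs_ballP[r /= r0 rs] : \forall w \near v + s, ~ E w /\ f w = f (v + s).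
  by apply: filterI; [exact: near_generic | exact: lf].
have [t [ft st]] := cs _ (nbhsx_ballx s (r / 2) (divr_gt0 r0 (ltr0Sn _ _))).
have Qv : \forall w \near v, (~ E w /\ f w = f v) /\ ball v (r / 2) w.
  apply: filterI; last by apply: nbhsx_ballx; rewrite divr_gt0.
  by apply: filterI; [exact: near_generic | exact: lf].
have [w [[Ew fw] vw] Ewt] := near_shift_generic t Qv.
have /rs[_ <-] : ball (v + s) r (w + t).
  move: vw st; rewrite -!ball_normE/= => vw st.
  rewrite opprD addrACA (le_lt_trans (ler_normD _ _))// (splitr r).
  by rewrite ltrD.
by rewrite ft // fw.
Qed.

Lemma shift_acts0 : shift_acts E f id 0.
Proof. by move=> v _ _; rewrite addr0. Qed.

Lemma shift_acts_sym (phi psi : T -> T) s : cancel phi psi ->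
  shift_acts E f phi s -> shift_acts E f psi (- s).
Proof.
by move=> phiK fs v Ev Evs; rewrite -[in RHS](subrK s v) fs ?phiK ?subrK.
Qed.

End ShiftActs.

(** * Closed subgroups of R^d *)

Lemma compact_seq_cluster {R : realType} {V : normedModType R} (K : set V)
    (u : nat -> V) : compact K -> (forall n, K (u n)) ->
  exists2 p, K p & forall e, 0 < e -> forall N, exists2 n, (N <= n)%N & `|p - u n| < e.
Proof.
move=> cK Ku.
have uK : (u @ \oo) K by exists 0%N => // n _; exact: Ku.
have [p [Kp clp]] := cK (u @ \oo) _ uK.
exists p => // e e0 N.
have uN : (u @ \oo) (u @` [set n | (N <= n)%N]).
  by exists N => // n /= Nn; exists n.
have [_ [[n Nn <-] pn]] := clp _ _ uN (nbhsx_ballx p e e0).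
by exists n => //; move: pn; rewrite -ball_normE.
Qed.

Section ClosedSubgroup.
Context {R : realType} {d : nat}.
Variable H : set 'rV[R]_d.
Hypotheses (cH : closed H) (H0 : H 0) (HB : forall x y, H x -> H y -> H (x - y)).

Lemma subgroup_opp x : H x -> H (- x).
Proof. by rewrite -sub0r; exact: HB. Qed.

Lemma subgroup_add x y : H x -> H y -> H (x + y).
Proof. by move=> Hx Hy; rewrite -[y]opprK; apply: HB => //; exact: subgroup_opp. Qed.

Lemma subgroup_mulz x (n : int) : H x -> H (x *~ n).
Proof.
move=> Hx; have Hn k : H (x *+ k).
  by elim: k => [//|k IH]; rewrite mulrS; exact: subgroup_add.
by case: n => n; rewrite ?NegzE ?mulrNz; [|apply: subgroup_opp]; exact: Hn.
Qed.

(* Short vectors [h] of [H] outside [U] are first projected to a complement of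
   [U]; a cluster point [u] of their directions then spans a line in [H],
   because integer multiples of [h] come within [|h|] of [r *: (h / |h|)]. *)
Lemma closed_subgroup_line (U : 'M[R]_d) :
  (forall x : 'rV_d, (x <= U)%MS -> H x) ->
  (forall e, 0 < e -> exists h, [/\ H h, `|h| < e & ~~ (h <= U)%MS]) ->
  exists2 u : 'rV_d, ~~ (u <= U)%MS & forall r, H (r *: u).
Proof.
(* On row vectors [Q] is an idempotent whose kernel is the row space of [U], so [x - x *m Q] always
   lies in [U], hence in [H]. *)
move=> HU short; pose Q := cokermx U *m pinvmx (cokermx U).
have QE (x : 'rV_d) : x *m Q *m cokermx U = x *m cokermx U.
  by rewrite /Q mulmxA mulmxKpV// submxMl.
have QQ (x : 'rV_d) : x *m Q *m Q = x *m Q by rewrite {2}/Q mulmxA QE /Q mulmxA.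
(* [c] bounds the stretching by [Q]; the short vectors are taken shorter by this factor before they
   are projected. *)
pose c : R := d%:R * `|Q| + 1.
have c0 : 0 < c by rewrite ltr_wpDl// mulr_ge0.
have /choice[h hP] n : exists h : 'rV_d,
    [/\ H h, `|h| < n.+1%:R^-1, h *m Q = h & h != 0].
  have [|h [Hh hn hU]] := short (n.+1%:R^-1 / c); first by rewrite divr_gt0.
  exists (h *m Q); split=> //.
  - rewrite -[h *m Q](subrK h); apply: subgroup_add => //; apply: HU.
    by rewrite submxE mulmxBl QE subrr.
  - rewrite (le_lt_trans (mx_norm_mulmx_le _ _))// mulrCA.
    move: hn; rewrite ltr_pdivlMr//; apply: le_lt_trans.
    by rewrite ler_wpM2l// lerDl.
  - apply: contraNneq hU => hQ0.
    by rewrite submxE -QE hQ0 mul0mx.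
have hn0 n : 0 < `|h n| by have [_ _ _] := hP n; rewrite normr_gt0.
pose K := [set x : 'rV[R]_d | `|x| = 1 /\ x *m Q = x].
have cK : compact K.
  apply: bounded_closed_compact.
    by exists 1; split=> // M M1 x [x1 _]; rewrite /= x1 ltW.
  have -> : K = (fun x : 'rV[R]_d => `|x|) @^-1` [set 1] `&`
               (fun x : 'rV[R]_d => x *m (Q - 1%:M)) @^-1` [set 0].
    apply/seteqP; split=> x [x1]; rewrite /= mulmxBr mulmx1.
      by move=> ->; rewrite subrr.
    by move=> /eqP; rewrite subr_eq0 => /eqP.
  apply: closedI; apply: preimage_closed;
    try exact/accessible_closed_set1/hausdorff_accessible/norm_hausdorff.
    by move=> x _; exact: norm_continuous.
  by move=> x _; exact: mulmxr_continuous.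
have [|u [u1 uQ] uh] := @compact_seq_cluster _ _ K (fun n => `|h n|^-1 *: h n) cK.
  move=> n; have [_ _ hQ _] := hP n; split.
    by rewrite normrZ normfV normr_id mulVf// gt_eqF.
  by rewrite -scalemxAl hQ.
exists u => [|r].
  apply/negP; rewrite submxE => /eqP uU.
  by move: u1; rewrite -uQ /Q mulmxA uU mul0mx normr0 => /esym/eqP; rewrite oner_eq0.
apply: cH => B /nbhs_ballP[e /= e0 Be].
(* For [n >= N] the bound [n.+1%:R^-1] on [|h n|] is below [e / 2]. *)
pose N := Num.trunc (2 / e).
have e2 : 0 < e / 2 / (`|r| + 1) by rewrite !divr_gt0// ltr_wpDl.
have [n Nn uhn] := uh _ e2 N.
have [Hh hn _ _] := hP n.
exists (h n *~ Num.floor (r / `|h n|)); split; first exact: subgroup_mulz.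
apply: Be; rewrite -ball_normE /=.
have -> : r *: u - h n *~ Num.floor (r / `|h n|) =
    r *: (u - `|h n|^-1 *: h n) + (r / `|h n| - (Num.floor (r / `|h n|))%:~R) *: h n.
  by rewrite scalerBr scalerA scalerBl addrA subrK scaler_int.
rewrite (le_lt_trans (ler_normD _ _))// (splitr e) ltrD//.
  rewrite normrZ; move: uhn; rewrite ltr_pdivlMr ?ltr_wpDl//; apply: le_lt_trans.
  by rewrite mulrC ler_wpM2l// lerDl.
have hne : `|h n| < e / 2.
  rewrite (lt_le_trans hn)// -[leRHS]invrK lef_pV2 ?posrE ?invr_gt0 ?divr_gt0//.
  by rewrite invf_div (le_trans (ltW (truncnS_gt _)))// ler_nat ltnS.
rewrite normrZ (le_lt_trans _ hne)// ler_piMl//.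
have /andP[fl fu] := floor_itv (r / `|h n|).
by rewrite ger0_norm ?subr_ge0// lerBlDl (le_trans (ltW fu))// intrD.
Qed.

(** Let [U] be a subspace of largest dimension inside [H]. If no positive multiple of [s] falls in
    the lattice plus [U], the multiples of [s] reduced modulo the lattice have a cluster point;
    their differences are arbitrarily short elements of [H] outside [U], and the resulting line
    would enlarge [U]. *)
Lemma closed_subgroup_multiple (B : 'M[R]_d) (s : 'rV[R]_d) : B \in unitmx ->
  (forall z : 'rV[int]_d, H (map_mx intr z *m B)) -> H s ->
  exists (n : nat) (z : 'rV[int]_d) (v : 'rV[R]_d),
    [/\ (0 < n)%N, s *+ n = map_mx intr z *m B + v & forall r, H (r *: v)].
Proof.
move=> uB HM Hs.
pose subspace r := `[< exists U : 'M[R]_d, \rank U = r /\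
  forall x : 'rV_d, (x <= U)%MS -> H x >].
have sub0 : exists r, subspace r.
  exists 0%N; apply/asboolP; exists 0; split; first exact: mxrank0.
  by move=> x; rewrite submx0 => /eqP ->.
have subd r : subspace r -> (r <= d)%N.
  by move=> /asboolP[U [<- _]]; exact: rank_leq_row.
have [r /asboolP[U [rU HU]] rmax] := ex_maxnP sub0 subd.
have [[n [z [n0 nz]]]|no] := pselect (exists n (z : 'rV[int]_d),
    (0 < n)%N /\ (s *+ n - map_mx intr z *m B <= U)%MS).
  exists n, z, (s *+ n - map_mx intr z *m B); split=> // [|a].
    by rewrite addrC subrK.
  exact/HU/scalemx_sub.
have [|u uU Hu] := @closed_subgroup_line U HU.
  move=> e e0.
  (* Taking floors of the coordinates in the basis [B] reduces [s *+ i] into the fundamental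
     parallelepiped, which is compact. *)
  pose z i : 'rV[int]_d := \row_j Num.floor ((s *+ i *m invmx B) 0 j).
  pose x i := s *+ i - map_mx intr (z i) *m B.
  pose C := [set c : 'rV[R]_d | forall i, `[0, 1]%classic (c ord0 i)].
  have cK : compact ((fun c : 'rV[R]_d => c *m B) @` C).
    apply: continuous_compact; first exact/continuous_subspaceT/mulmxr_continuous.
    by apply: (@rV_compact R _ (fun=> `[0, 1]%classic)) => i; exact: segment_compact.
  have [|p _ xp] := compact_seq_cluster (u := x) cK.
    move=> i; exists (s *+ i *m invmx B - map_mx intr (z i)); last first.
      by rewrite mulmxBl mulmxKV.
    move=> j; rewrite /= in_itv/= !mxE.
    have /andP[fl fu] := floor_itv ((s *+ i *m invmx B) 0 j).
    move: fl fu; rewrite !mxE => fl fu.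
    by rewrite subr_ge0 fl/= lerBlDl (le_trans (ltW fu))// intrD.
  have e2 : 0 < e / 2 by rewrite divr_gt0.
  have [i _ xi] := xp _ e2 0%N.
  have [j ij xj] := xp _ e2 i.+1.
  have xE : x j - x i = s *+ (j - i) - map_mx intr (z j - z i) *m B.
    rewrite /x mulrnBr ?(ltnW ij)// map_mxB mulmxBl !opprB.
    by rewrite addrACA [RHS]addrACA [in RHS](addrC (- _)).
  exists (x j - x i); split.
  - have Hx k : H (x k) by rewrite /x; apply: (HB _ (HM _)); exact: (@subgroup_mulz s k Hs).
    exact: HB.
  - rewrite -(subrKA p) (le_lt_trans (ler_normD _ _))// (splitr e) ltrD//.
    by rewrite distrC.
  - apply/negP => xU; apply: no; exists (j - i)%N, (z j - z i).
    by rewrite subn_gt0 ij -xE.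
have : subspace (\rank (U + u)%MS).
  apply/asboolP; exists (U + u)%MS; split=> // x /sub_addsmxP[[a b] ->].
  apply: subgroup_add; first exact/HU/submxMl.
  by have /sub_rVP[c ->] := submxMl b u; exact: Hu.
move=> /rmax; rewrite -rU leqNgt => /negP[].
apply: rank_ltmx; rewrite ltmxE addsmxSl/=.
by apply: contra uU; rewrite addsmx_sub => /andP[].
Qed.

End ClosedSubgroup.

(** * Counting lattice points *)

Section Boundary.
Context {T : topologicalType}.
Variable P : set T.
Hypothesis cP : closed P.

Lemma boundary_sub : boundary P `<=` P.
Proof. by move=> x [/cP]. Qed.

Lemma closed_boundary : closed (boundary P).
Proof.
apply: closedI; first exact: closed_closure.
exact/open_closedC/open_interior.
Qed.

(** An open set inside the boundary would lie in the closed set [P], hence in its interior, which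
    the boundary excludes. *)
Lemma dense_setC_boundary : dense (~` boundary P).
Proof.
apply: contrapT => /denseNE[U [[x [oU Ux]] UP]].
have UbP : U `<=` boundary P.
  by move=> y Uy; apply: contrapT => Py; have : (U `&` ~` boundary P) y by []; rewrite UP.
have [_] := UbP _ Ux; apply.
have : nbhs x U by apply: open_nbhs_nbhs; split.
by apply: filterS; exact: subset_trans UbP boundary_sub.
Qed.

Lemma near_setC_boundary x : ~ boundary P x ->
  \forall y \near x, ~ boundary P y /\ (P y <-> P x).
Proof.
move=> bx; have [Px|nPx] := pselect (P x).
  have ix : P^° x.
    by apply: contrapT => ix; apply: bx; split => //; exact: subset_closure.
  have : nbhs x P^° by apply: open_nbhs_nbhs; split => //; exact: open_interior.
  apply: filterS => y iy; split; first by move=> [].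
  by split=> // _; exact: interior_subset iy.
have : nbhs x (~` P) by apply: open_nbhs_nbhs; split => //; exact: closed_openC.
apply: filterS => y nPy; split; last by split.
by move=> /boundary_sub.
Qed.

End Boundary.

Definition box {d : nat} (J : nat) : set 'rV[int]_d :=
  [set z | forall i, `|z 0 i| <= J%:Z].

Definition box_index {d : nat} (J : nat) (r : 'rV['I_J.*2.+1]_d) : 'rV[int]_d :=
  \row_i ((r 0 i : nat)%:Z - J%:Z).

(** There are [J.*2.+1] integers from [- J] to [J]; this parametrization gives both the finiteness
    and the cardinality of the box. *)
Lemma box_index_bij d J : set_bij [set: 'rV['I_J.*2.+1]_d] (box J) (@box_index d J).
Proof.
split.
- move=> r _ i; rewrite mxE ler_norml; move: (nat_of_ord (r 0 i)) (ltn_ord (r 0 i)).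
  by move=> n; lia.
- move=> r s _ _ /rowP rs; apply/rowP => i; apply/val_inj => /=.
  by have := rs i; rewrite !mxE => /addIr[].
- move=> z zJ; have zi i : (absz (z 0%R i + J%:Z)%R < J.*2.+1)%N.
    by have := zJ i; rewrite ler_norml; lia.
  exists (\row_i Ordinal (zi i)) => //; apply/rowP => i.
  rewrite !mxE /=; have := zJ i; rewrite ler_norml; lia.
Qed.

Lemma finite_box d J : finite_set (@box d J).
Proof.
have [_ _ /(_ _ _)sub] := @box_index_bij d J.
by apply: (sub_finite_set sub); apply: finite_image; exact: finite_finset.
Qed.

Section Hits.
Context {R : realType} {d : nat}.
Implicit Types (P : set 'rV[R]_d) (B : 'M[R]_d) (z : 'rV[int]_d).

Definition lattice_point B z : 'rV[R]_d := map_mx intr z *m B.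

Definition hits B P (v : 'rV[R]_d) : set 'rV[int]_d :=
  [set z | P (v - lattice_point B z)].

(** [fset_set] of an infinite set is empty, so this is the true count only once [finite_hits]
    applies. *)
Definition hit_count B P (v : 'rV[R]_d) : nat := #|` fset_set (hits B P v)|%fset.

Definition walls B P : set 'rV[R]_d :=
  minkowski_sum (boundary P) [set lattice_point B z | z in setT].

Lemma lattice_pointD B z w :
  lattice_point B (z + w) = lattice_point B z + lattice_point B w.
Proof. by rewrite /lattice_point map_mxD mulmxDl. Qed.

Lemma lattice_pointN B z : lattice_point B (- z) = - lattice_point B z.
Proof. by rewrite /lattice_point map_mxN mulNmx. Qed.

Lemma lattice_point0 B : lattice_point B 0 = 0.
Proof. by rewrite /lattice_point map_mx0 mul0mx. Qed.

Lemma lattice_point_inj B : B \in unitmx -> injective (lattice_point B).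
Proof.
move=> uB z w /(congr1 (mulmx^~ (invmx B))); rewrite !mulmxK//.
by move=> /rowP zw; apply/rowP => i; have := zw i; rewrite !mxE => /intr_inj.
Qed.

Lemma wallsP B P v : walls B P v <-> exists z, boundary P (v - lattice_point B z).
Proof.
split=> [[b bP [_ [z _ <-]] <-]|[z bz]]; first by exists z; rewrite addrK.
by exists (v - lattice_point B z) => //; exists (lattice_point B z);
  [exists z | rewrite subrK].
Qed.

Variables (B : 'M[R]_d) (P : set 'rV[R]_d).
Hypotheses (uB : B \in unitmx) (cP : compact P).

Let closedP : closed P. Proof. by apply: compact_closed => //; exact: norm_hausdorff. Qed.

(** The lattice point of a hit is the difference of [v] and a point of [P], both bounded; applying
    [invmx B] bounds its coordinates uniformly in [v]. *)
Lemma hits_box (rho : R) : exists J, forall v, `|v| <= rho -> hits B P v `<=` box J.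
Proof.
have [M [_ PM]] := compact_bounded cP.
pose c : R := d%:R * ((rho + (M + 1)) * `|invmx B|).
exists (Num.trunc c).+1 => v vr z Pz i.
have M1 : M < M + 1 by rewrite ltrDl.
have /= Pz1 := PM _ M1 _ Pz.
have zE : map_mx intr z = (v - (v - lattice_point B z)) *m invmx B.
  by rewrite opprB addrC subrK mulmxK.
have : `|(map_mx intr z : 'rV[R]_d)| <= c.
  rewrite zE (le_trans (mx_norm_mulmx_le _ _))// ler_wpM2l// ler_wpM2r//.
  by rewrite (le_trans (ler_normB _ _))// lerD.
move=> /(le_trans (le_mx_entry _ 0 i)); rewrite mxE -intr_norm => zc.
rewrite -(ler_int R) (le_trans zc)// ltW//.
exact: truncnS_gt.
Qed.

Lemma finite_hits v : finite_set (hits B P v).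
Proof.
have [J hJ] := hits_box `|v|.
exact: sub_finite_set (hJ v (lexx _)) (@finite_box _ _).
Qed.

(** For [w] within distance 1 of [v] all hits lie in one finite box, so finitely many conditions,
    each stable near [v], have to be met. The box also controls the walls, because the boundary is
    contained in [P]. *)
Lemma hits_near v : ~ walls B P v ->
  \forall w \near v, ~ walls B P w /\ hits B P w = hits B P v.
Proof.
move=> wv; have [J hJ] := hits_box (`|v| + 1).
have nz z : \forall w \near v, ~ boundary P (w - lattice_point B z) /\
    (hits B P w z <-> hits B P v z).
  apply: (@near_shift _ _ v (- lattice_point B z) [set w | ~ boundary P w /\
    (P w <-> P (v - lattice_point B z))]).
  apply: (near_setC_boundary closedP (x := v - lattice_point B z)) => bz.
  by apply: wv; apply/wallsP; exists z.
have : \forall w \near v, (\bigcap_(z in [set` fset_set (box J)])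
    [set w | ~ boundary P (w - lattice_point B z) /\
    (hits B P w z <-> hits B P v z)]) w.
  by apply: filter_bigI => z _; exact: nz.
have : \forall w \near v, ball v 1 w by exact: nbhsx_ballx.
apply: filterS2 => w vw hw.
have wv1 : `|w| <= `|v| + 1.
  move: vw; rewrite -ball_normE /= distrC => vw.
  by rewrite -lerBlDl (le_trans (lerB_dist _ _))// ltW.
have vv1 : `|v| <= `|v| + 1 by rewrite lerDl.
have wz z : box J z -> ~ boundary P (w - lattice_point B z) /\
    (hits B P w z <-> hits B P v z).
  by move=> Jz; apply: hw; rewrite /= in_fset_set ?inE//; exact: finite_box.
split.
  move=> /wallsP[z bz]; have [] // := wz z.
  by apply: (hJ w wv1); exact: boundary_sub bz.
by apply/seteqP; split=> z hz; [have [_ []] := wz z (hJ w wv1 z hz)|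
  have [_ []] := wz z (hJ v vv1 z hz)]; auto.
Qed.

(** Density is the Baire theorem: the generic points form a countable intersection of dense open
    sets. *)
Lemma walls_locally_constant : locally_constant_off (walls B P) (hits B P).
Proof.
split.
- by rewrite openE => v /hits_near; apply: filterS => w [].
(* The integer vectors are enumerated by [unpickle]; a number that codes no vector contributes the
   whole space. *)
- pose F n : set 'rV[R]_d :=
    if unpickle n is Some z then (fun v => v - lattice_point B z) @^-1` ~` boundary P
    else setT.
  have -> : ~` walls B P = \bigcap_n F n.
    apply/seteqP; split=> v wv.
      move=> n _; rewrite /F; case: unpickle => // z bz.
      by apply: wv; apply/wallsP; exists z.
    move=> /wallsP[z bz]; have := wv (pickle z) I; rewrite /F pickleK; exact.
  suff FE n : open (F n) /\ dense (F n).
    exact: (@Baire R (HB.pack_for (completeNormedModType R) 'rV[R]_d) F FE).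
  rewrite /F; case: unpickle => [z|].
    split; first exact/open_shift/closed_openC/closed_boundary.
    move=> U [u Uu] oU.
    have [| |w [Uw bw]] := dense_setC_boundary closedP
      (O := [set w | U (w + lattice_point B z)]).
    + by exists (u - lattice_point B z); rewrite /= subrK.
    + exact: open_shift.
    + by exists (w + lattice_point B z); split=> //=; rewrite addrK.
  by split; [exact: openT | move=> U [u Uu] _; exists u].
- by move=> v /hits_near; apply: filterS => w [].
Qed.

End Hits.

Lemma esum_cst {R : realType} {T : choiceType} (A : set T) (c : R) :
  finite_set A -> 0 <= c ->
  \esum_(z in A) c%:E = (#|` fset_set A|%fset%:R * c)%:E.
Proof.
move=> fA c0; rewrite esum_fset// fsbig_finite//= sumEFin; congr (_%:E).
by rewrite big_const_seq count_predT iter_addr_0 mulr_natl.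
Qed.

Lemma esum_exchange {R : realType} {T1 T2 : choiceType} (A1 : set T1) (A2 : set T2)
    (f : T1 -> T2 -> \bar R) : (forall i j, 0 <= f i j)%E ->
  \esum_(i in A1) \esum_(j in A2) f i j = \esum_(j in A2) \esum_(i in A1) f i j.
Proof.
move=> f0; rewrite !esum_esum//.
rewrite (@reindex_esum _ _ _ (A2 `*`` fun=> A1) (A1 `*`` fun=> A2) (fun k => (k.2, k.1)))//.
split.
- by move=> [j i] [].
- by move=> [j i] [j' i'] _ _ /= [-> ->].
- by move=> [i j] [Ai Aj]; exists (j, i).
Qed.

(** * Sums over a lattice and tilings *)

Section Tiling.
Context {R : realType} {d : nat}.
Variables (B : 'M[R]_d) (P : set 'rV[R]_d).
Hypothesis uB : B \in unitmx.
Notation M := [set lattice_point B z | z in setT].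

Lemma translateP (A : set 'rV[R]_d) (t v : 'rV[R]_d) : translate A t v <-> A (v - t).
Proof.
split=> [[x Ax <-]|Avt]; first by rewrite addrK.
by exists (v - t); rewrite ?subrK.
Qed.

Lemma esum_translate_lattice (a : 'rV[R]_d) (g : 'rV[R]_d -> \bar R) :
  \esum_(l in translate M a) g l = \esum_(z in [set: 'rV[int]_d]) g (lattice_point B z + a).
Proof.
apply: reindex_esum; split.
- by move=> z _; exists (lattice_point B z) => //; exists z.
- by move=> z w _ _ /addIr; exact: lattice_point_inj.
- by move=> _ [_ [z _ <-] <-]; exists z.
Qed.

Lemma esum_hits (a v : 'rV[R]_d) (g : 'rV[int]_d -> R) : (forall z, 0 <= g z) ->
  \esum_(z in setT) (g z * \1_(translate P (lattice_point B z + a)) v)%:E =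
  \esum_(z in hits B P (v - a)) (g z)%:E.
Proof.
move=> g0; rewrite [RHS]esum_mkcond; apply: eq_esum => z _.
rewrite indicE; case: ifPn => [/set_mem hz|hz].
  by rewrite mem_set ?mulr1//; apply/translateP; rewrite opprD addrCA addrC.
rewrite memNset ?mulr0// => /translateP Pz; move/negP: hz; apply; apply/mem_set.
by rewrite /hits/= -addrA -opprD addrC addrC [a + _]addrC.
Qed.

Lemma hits_shift (v : 'rV[R]_d) w :
  hits B P (v + lattice_point B w) = [set z + w | z in hits B P v].
Proof.
apply/seteqP; split=> [z|_ [z hz <-]].
  move=> hz; exists (z - w); last by rewrite subrK.
  by move: hz; rewrite /hits/= lattice_pointD lattice_pointN opprB addrA addrAC.
by move: hz; rewrite /hits/= lattice_pointD opprD addrACA subrr addr0.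
Qed.

Lemma esum_hits_shift (v : 'rV[R]_d) w (g : 'rV[int]_d -> \bar R) :
  \esum_(z in hits B P (v + lattice_point B w)) g z =
  \esum_(z in hits B P v) g (z + w).
Proof.
apply: reindex_esum; split.
- by move=> z hz; rewrite hits_shift; exists z.
- by move=> z z' _ _ /addIr.
- by move=> z; rewrite hits_shift.
Qed.

Hypothesis cP : compact P.

Lemma esum_hits_cst v (c : R) : 0 <= c ->
  \esum_(z in hits B P v) c%:E = ((hit_count B P v)%:R * c)%:E.
Proof. by apply: esum_cst; exact: finite_hits. Qed.

Lemma esum_hits1 v : \esum_(z in hits B P v) 1%:E = (hit_count B P v)%:R%:E :> \bar R.
Proof. by rewrite esum_hits_cst// mulr1. Qed.

Lemma hit_count_shift v w : hit_count B P (v + lattice_point B w) = hit_count B P v.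
Proof.
(* Cardinals are compared as sums of ones, so that reindexing the sum suffices. *)
have : (hit_count B P (v + lattice_point B w))%:R%:E = (hit_count B P v)%:R%:E :> \bar R.
  by rewrite -!esum_hits1 esum_hits_shift.
by move=> [] /eqP; rewrite eqr_nat => /eqP.
Qed.

Lemma k_tiles_lattice m : (forall v, ~ walls B P v -> hit_count B P v = m) ->
  k_tiles m P (multiset_of_set M).
Proof.
have MM : multiset_support (multiset_of_set M) = M.
  apply/seteqP; split=> x; rewrite /multiset_support /multiset_of_set /=.
    by rewrite lt0b => /set_mem.
  by move=> Mx; rewrite mem_set.
move=> hm v; rewrite MM => /hm <-.
have -> : \esum_(l in [set: 'rV[R]_d])
    ((multiset_of_set M l)%:R * \1_(translate P l) v)%:E =
    \esum_(l in translate M 0) (1 * \1_(translate P l) v)%:E :> \bar R.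
  rewrite [RHS]esum_mkcond; apply: eq_esum => l _; rewrite /multiset_of_set.
  have -> : translate M 0 = M.
    by apply/seteqP; split=> x; rewrite translateP subr0.
  by case: ifPn => _; rewrite ?mul0r.
by rewrite esum_translate_lattice esum_hits// subr0 esum_hits1.
Qed.

End Tiling.

(** * Cosets of a lattice in a finer one *)

Section Refine.
Context {R : realType} {d n : nat}.
Variables (B : 'M[R]_d) (P : set 'rV[R]_d).
Hypotheses (uB : B \in unitmx) (cP : compact P).
Notation B' := (n.+1%:R^-1 *: B).

Lemma refine_unitmx : B' \in unitmx.
Proof. by rewrite unitmxZ// unitfE invr_eq0 pnatr_eq0. Qed.

Lemma lattice_point_refine z : lattice_point B' (n.+1%:Z *: z) = lattice_point B z.
Proof.
rewrite /lattice_point map_mxZ -scalemxAl -scalemxAr scalerA.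
by rewrite mulfV ?scale1r// pnatr_eq0.
Qed.

(** In the basis [B'] the original lattice is the set of vectors with all coordinates divisible by
    [n.+1]; the residues represent its cosets. *)
Definition residue (r : 'rV['I_n.+1]_d) : 'rV[int]_d :=
  map_mx (fun i : 'I_n.+1 => (i : nat)%:Z) r.

Lemma residue_bij : set_bij ([set: 'rV['I_n.+1]_d] `*`` fun=> [set: 'rV[int]_d]) setT
  (fun k => residue k.1 + n.+1%:Z *: k.2).
Proof.
have modE (r q : 'rV_d) i : modz ((residue r + n.+1%:Z *: q) 0 i) n.+1 = r 0 i.
  by rewrite !mxE addrC mulrC modzMDl modz_small//= ltz_nat ltn_ord.
split => //.
- move=> [r q] [r' q'] _ _ /= e.
  have er : r = r'.
    apply/rowP => i; apply/val_inj; have := modE r q i; rewrite e modE.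
    by case.
  move: e; rewrite er => /addrI /rowP e; congr pair; apply/rowP => i.
  by have := e i; rewrite !mxE => /mulfI; apply.
- move=> z _; pose p i : nat := absz (modz (z 0 i) n.+1).
  have pE i : (p i)%:Z = modz (z 0 i) n.+1 by rewrite gez0_abs// modz_ge0.
  have pn i : (p i < n.+1)%N by rewrite -ltz_nat pE ltz_pmod.
  exists (\row_i Ordinal (pn i), \row_i divz (z 0 i) n.+1) => //=.
  apply/rowP => i; rewrite !mxE /= pE mulrC addrC.
  by rewrite -divz_eq.
Qed.

Lemma hit_count_refine v : hit_count B' P v =
  (\sum_r hit_count B P (v - lattice_point B' (residue r)))%N.
Proof.
have uB' := refine_unitmx.
have : (hit_count B' P v)%:R%:E =
    (\sum_r hit_count B P (v - lattice_point B' (residue r)))%N%:R%:E :> \bar R.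
  have finT : finite_set [set: 'rV['I_n.+1]_d] by exact: finite_finset.
  rewrite -esum_hits1// esum_mkcond (reindex_esum _ _ _ _ residue_bij).
  (* The hits are not a product set in the pair of residue and quotient; the summand is extended by
     zero so that the sum can be iterated. *)
  rewrite -(esum_esum (a := fun r q =>
    if residue r + n.+1%:Z *: q \in hits B' P v then 1%:E else 0)); last first.
    by move=> r q _ _; case: ifP.
  rewrite (eq_esum (b := fun r =>
    (hit_count B P (v - lattice_point B' (residue r)))%:R%:E)).
    rewrite esum_fset// fsbig_finite//= sumEFin natr_sum; congr (_%:E).
    rewrite -[RHS]big_enum /=.
    apply: perm_big; apply: uniq_perm; rewrite ?enum_uniq ?fset_uniq// => r.
    by rewrite mem_enum in_fset_set// mem_set.
  move=> r _; rewrite -esum_hits1// [RHS]esum_mkcond; apply: eq_esum => q _.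
  have hE : hits B' P v (residue r + n.+1%:Z *: q) =
      hits B P (v - lattice_point B' (residue r)) q.
    by rewrite /hits/= -lattice_point_refine lattice_pointD opprD addrA.
  congr (if _ then _ else _).
  by apply/idP/idP => /set_mem h; apply/mem_set; [rewrite -hE | rewrite hE].
by move=> [] /eqP; rewrite eqr_nat => /eqP.
Qed.

End Refine.

(** * Averages over boxes *)

Lemma le_esum_set {R : realType} {T : choiceType} (A1 A2 : set T) (f : T -> \bar R) :
  (forall x, 0 <= f x)%E -> A1 `<=` A2 ->
  (\esum_(x in A1) f x <= \esum_(x in A2) f x)%E.
Proof.
move=> f0 A12; rewrite esum_mkcond [leRHS]esum_mkcond; apply: le_esum => x _.
case: ifPn => [/set_mem/A12/mem_set ->//|_]; by case: ifP.
Qed.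

Section BoxSum.
Context {R : realType} {d : nat}.
Implicit Types (f : 'rV[int]_d -> R) (z : 'rV[int]_d).

Definition box_sum f N : R := \sum_(z <- fset_set (box N)) f z.

Lemma esum_box f N : (forall z, 0 <= f z) ->
  \esum_(z in box N) (f z)%:E = (box_sum f N)%:E.
Proof.
move=> f0; have fb := @finite_box d N.
by rewrite esum_fset// ?fsbig_finite//= ?sumEFin// => z _; rewrite lee_fin.
Qed.

Lemma box_sum_ge0 f N : (forall z, 0 <= f z) -> 0 <= box_sum f N.
Proof. by move=> f0; apply: sumr_ge0. Qed.

Lemma box_sum1 N : box_sum (fun=> 1) N = (N.*2.+1)%:R ^+ d.
Proof.
apply: EFin_inj; rewrite -esum_box// (reindex_esum _ _ _ _ (@box_index_bij d N)).
rewrite esum_cst//; last exact: finite_finset.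
have -> : fset_set [set: 'rV['I_N.*2.+1]_d] = [fset x in enum 'rV['I_N.*2.+1]_d]%fset.
  have fT : finite_set [set: 'rV['I_N.*2.+1]_d] by exact: finite_finset.
  by apply/fsetP => r; rewrite in_fset_set// inE mem_enum mem_set.
rewrite mulr1 card_fseq undup_id ?enum_uniq// -cardE card_mx card_ord.
by rewrite mul1n natrX.
Qed.

Lemma esum_shift (A : set 'rV[int]_d) (F : 'rV[int]_d -> \bar R) z :
  \esum_(n in A) F (z + n) = \esum_(n in [set z + n | n in A]) F n.
Proof.
apply/esym/reindex_esum; split => [n An|n m _ _ /addrI|//] //.
by exists n.
Qed.

(** Translation by [z] maps [box N] into [box (N + J)]. *)
Lemma box_sum_shift_le f z J N : (forall z, 0 <= f z) -> box J z ->
  (\esum_(n in box N) (f (z + n))%:E <= (box_sum f (N + J))%:E)%E.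
Proof.
move=> f0 Jz; rewrite -esum_box// (esum_shift _ (fun n => (f n)%:E)).
apply: le_esum_set => [n|]; first by rewrite lee_fin.
move=> _ [n Nn <-] i; rewrite mxE (le_trans (ler_normD _ _))//.
by rewrite addrC PoszD lerD.
Qed.

(** The translate of [box (N + J)] by [z] covers [box N]. *)
Lemma box_sum_shift_ge f z J N : (forall z, 0 <= f z) -> box J z ->
  ((box_sum f N)%:E <= \esum_(n in box (N + J)) (f (z + n))%:E)%E.
Proof.
move=> f0 Jz; rewrite -esum_box// (esum_shift _ (fun n => (f n)%:E)).
apply: le_esum_set => [n|]; first by rewrite lee_fin.
move=> n Nn; exists (n - z); last by rewrite addrC subrK.
by move=> i; rewrite !mxE (le_trans (ler_normB _ _))// PoszD lerD.
Qed.

(** The ratio equals [(1 + 2 J / (2 N + 1)) ^ d]: enlarging a box by a fixed margin is negligible in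
    the limit. *)
Lemma box_sum_ratio_cvg J :
  box_sum (fun=> 1) (N + J) / box_sum (fun=> 1) N @[N --> \oo] --> (1 : R).
Proof.
have -> : (fun N => box_sum (fun=> 1) (N + J) / box_sum (fun=> 1) N) =
    (fun N => (1 + J.*2%:R * N.*2.+1%:R^-1) ^+ d) :> (nat -> R).
  apply/funext => N; rewrite !box_sum1 -expr_div_n; congr (_ ^+ d).
  have N0 : N.*2.+1%:R != 0 :> R by rewrite pnatr_eq0.
  by rewrite -[X in X + _](divff N0) -mulrDl -natrD doubleD addSn.
have lim0 : N.*2.+1%:R^-1 @[N --> \oo] --> (0 : R).
  apply: (@squeeze_cvgr _ _ _ _ (fun=> 0) harmonic).
  - apply: nearW => N; rewrite invr_ge0 ler0n/= lef_pV2 ?posrE// ler_nat ltnS.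
    by rewrite -addnn leq_addr.
  - exact: cvg_cst.
  - exact: cvg_harmonic.
have lim1 : 1 + J.*2%:R * N.*2.+1%:R^-1 @[N --> \oo] --> (1 : R).
  rewrite -[X in _ --> X]addr0; apply: cvgD; first exact: cvg_cst.
  by rewrite -[X in _ --> X](mulr0 J.*2%:R); apply: cvgMl_tmp.
rewrite -[X in _ --> X](expr1n R d).
exact: (cvg_comp _ _ lim1 (exprn_continuous (x := 1))).
Qed.

End BoxSum.

Section Averaging.
Context {R : realType} {d : nat}.
Variables (B : 'M[R]_d) (P : set 'rV[R]_d).
Hypotheses (uB : B \in unitmx) (cP : compact P).

Lemma esum_box_hits_le (f : 'rV[int]_d -> R) v J N :
  (forall z, 0 <= f z) -> hits B P v `<=` box J ->
  (\esum_(n in box N) \esum_(z in hits B P v) (f (z + n))%:E <=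
   ((hit_count B P v)%:R * box_sum f (N + J))%:E)%E.
Proof.
move=> f0 hJ; rewrite esum_exchange; last by move=> *; rewrite lee_fin.
rewrite -esum_hits_cst ?box_sum_ge0//; apply: le_esum => z /hJ Jz.
exact: box_sum_shift_le.
Qed.

Lemma esum_box_hits_ge (f : 'rV[int]_d -> R) v J N :
  (forall z, 0 <= f z) -> hits B P v `<=` box J ->
  (((hit_count B P v)%:R * box_sum f N)%:E <=
   \esum_(n in box (N + J)) \esum_(z in hits B P v) (f (z + n))%:E)%E.
Proof.
move=> f0 hJ; rewrite esum_exchange; last by move=> *; rewrite lee_fin.
rewrite -esum_hits_cst ?box_sum_ge0//; apply: le_esum => z /hJ Jz.
exact: box_sum_shift_ge.
Qed.

Variables (f g : 'rV[int]_d -> R) (k : R) (u v : 'rV[R]_d).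
Hypotheses (f0 : forall z, 0 <= f z) (g0 : forall z, 0 <= g z) (k0 : 0 <= k).
Hypothesis tile : forall n,
  (\esum_(z in hits B P u) (f (z + n))%:E +
   \esum_(z in hits B P v) (g (z + n))%:E = k%:E)%E.
Local Notation C := (@box_sum R d (fun=> 1)).
Local Notation x := ((hit_count B P u)%:R : R).
Local Notation y := ((hit_count B P v)%:R : R).

(** Summing [tile] over [n] in a box and exchanging sums leaves, for each hit, a box sum translated
    by that hit; the margin [J] absorbs the translation. *)
Lemma average_bounds : exists J, forall N,
  x * box_sum f N + y * box_sum g N <= k * C (N + J) /\
  k * C N <= x * box_sum f (N + J) + y * box_sum g (N + J).
Proof.
have [Ju hu] := hits_box uB cP `|u|; have [Jv hv] := hits_box uB cP `|v|.
have box_le (J J' : nat) : (J <= J')%N -> @box d J `<=` box J'.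
  by move=> JJ z zJ i; rewrite (le_trans (zJ i))// lez_nat.
pose J := maxn Ju Jv.
have huJ : hits B P u `<=` box J.
  by apply: subset_trans (hu _ (lexx _)) _; apply: box_le; exact: leq_maxl.
have hvJ : hits B P v `<=` box J.
  by apply: subset_trans (hv _ (lexx _)) _; apply: box_le; exact: leq_maxr.
have kC N : (k * C N)%:E = (\esum_(n in box N) \esum_(z in hits B P u) (f (z + n))%:E +
    \esum_(n in box N) \esum_(z in hits B P v) (g (z + n))%:E)%E.
  have C_E : (k * C N)%:E = \esum_(n in @box d N) k%:E.
    rewrite esum_cst//; last exact: finite_box.
    have -> : C N = #|` fset_set (@box d N)|%fset%:R.
      by rewrite /box_sum big_const_seq count_predT iter_addr_0.
    by rewrite mulrC.
  rewrite C_E -esumD//; last 2 first.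
  - by move=> n _; apply: esum_ge0 => z _; rewrite lee_fin.
  - by move=> n _; apply: esum_ge0 => z _; rewrite lee_fin.
  by apply: eq_esum => n _; rewrite tile.
exists J => N; split; rewrite -lee_fin kC EFinD.
  by apply: leeD; exact: esum_box_hits_ge.
by apply: leeD; exact: esum_box_hits_le.
Qed.

Lemma average_cvg :
  x * (box_sum f N / C N) + y * (box_sum g N / C N) @[N --> \oo] --> k.
Proof.
have [J bnd] := average_bounds.
have C0 N : 0 < C N by rewrite box_sum1 exprn_gt0// ltr0n.
have -> : (fun N => x * (box_sum f N / C N) + y * (box_sum g N / C N)) =
    (fun N => (x * box_sum f N + y * box_sum g N) / C N).
  by apply/funext => N; rewrite mulrDl !mulrA.
(* At index [N + J] the lower bound comes from [bnd N] and the upper one from [bnd (N + J)]. *)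
rewrite -(cvg_shiftn J).
apply: (@squeeze_cvgr _ _ _ _ (fun N => k * (C (N + J) / C N)^-1)
  (fun N => k * (C (N + J + J) / C (N + J)))).
- apply: nearW => N; have [_ le2] := bnd N; have [le1 _] := bnd (N + J)%N.
  by rewrite invf_div !mulrA ler_pM2r ?invr_gt0// ler_pdivrMr// divfK ?gt_eqF// le2.
- rewrite -[X in _ --> X]mulr1; apply: cvgMl_tmp; rewrite -[X in _ --> X]invr1.
  by apply: cvgV; [exact: oner_neq0 | exact: box_sum_ratio_cvg].
- rewrite -[X in _ --> X]mulr1; apply: cvgMl_tmp.
  rewrite (cvg_shiftn J (fun N => C (N + J) / C N)).
  exact: box_sum_ratio_cvg.
Qed.

End Averaging.

(* Two distinct points of [Q] are linearly independent, so they determine the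
   limits of [al] and [be]. *)
Lemma limit_weights {R : realType} (al be : nat -> R) (k : R) (Q : R -> R -> Prop) :
  0 < k -> (forall N, 0 <= al N) -> (forall N, 0 <= be N) ->
  (forall x y, Q x y -> x * al N + y * be N @[N --> \oo] --> k) ->
  (forall x y x' y', Q x y -> Q x' y' -> x = x' /\ y = y') \/
  exists a b, [/\ 0 <= a, 0 <= b & forall x y, Q x y -> x * a + y * b = k].
Proof.
move=> k0 al0 be0 Qk.
have [|ne] := pselect (forall x y x' y', Q x y -> Q x' y' -> x = x' /\ y = y').
  by left.
right; have [x [y [x' [y' [Qxy Qxy' nxy]]]]] : exists x y x' y',
    [/\ Q x y, Q x' y' & ~ (x = x' /\ y = y')].
  apply: contrapT => no; apply: ne => x y x' y' Qxy Qxy'.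
  by apply: contrapT => nxy; apply: no; exists x, y, x', y'.
have lim c c' : c * (x * al N + y * be N) + c' * (x' * al N + y' * be N)
    @[N --> \oo] --> c * k + c' * k.
  by apply: cvgD; apply: cvgMl_tmp; exact: Qk.
have limE c c' (u : nat -> R) l :
    (forall N, c * (x * al N + y * be N) + c' * (x' * al N + y' * be N) = u N) ->
    c * k + c' * k = l -> u N @[N --> \oo] --> l.
  by move=> /funext <- <-; exact: lim.
(* If the determinant vanished, combining the two limits with coefficients [- x'] and [x] would make
   the zero sequence tend to [(x - x') * k], forcing [x = x']; similarly [y = y']. *)
have D0 : x * y' - x' * y != 0.
  apply/eqP => D0; apply: nxy.
  have zero l : (cst 0 : nat -> R) @ \oo --> l -> l = 0.
    by move=> cl; apply: (cvg_unique (@Rhausdorff R) cl); exact: cvg_cst.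
  have kI l : l * k = 0 -> l = 0 by move/eqP; rewrite mulf_eq0 (gt_eqF k0) orbF => /eqP.
  split; apply/eqP; rewrite -subr_eq0; apply/eqP/kI/zero.
    apply: (limE (- x') x) => [N|]; last by ring.
    rewrite /cst; transitivity ((x * y' - x' * y) * be N); first by ring.
    by rewrite D0 mul0r.
  apply: (limE (- y') y) => [N|]; last by ring.
  rewrite /cst; transitivity (- (x * y' - x' * y) * al N); first by ring.
  by rewrite D0 oppr0 mul0r.
pose D := x * y' - x' * y.
(* Both limits are read off by Cramer's rule. *)
have al_cvg : al N @[N --> \oo] --> (y' - y) * k / D.
  apply: (limE (y' / D) (- y / D)) => [N|]; last by field.
  by rewrite /D; field.
have be_cvg : be N @[N --> \oo] --> (x - x') * k / D.
  apply: (limE (- x' / D) (x / D)) => [N|]; last by field.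
  by rewrite /D; field.
exists ((y' - y) * k / D), ((x - x') * k / D); split.
- by apply: (ler_cvg_to (cvg_cst 0) al_cvg); exact: nearW.
- by apply: (ler_cvg_to (cvg_cst 0) be_cvg); exact: nearW.
- move=> x0 y0 /Qk q0; apply: (cvg_unique (@Rhausdorff R) _ q0).
  by apply: cvgD; apply: cvgMl_tmp.
Qed.

(** * From the tiling identity to a lattice *)

(* If [h v] is not the fixed point of the affine contraction taking [h v] to
   [h (v + t)], iterating the shift by [t] makes the integer distance
   [|h v - h (v + t)|] decrease forever. *)
Lemma contracting_shift {R : realType} {V : normedModType R} (E : set V)
    (h : V -> nat) (al be k : R) (t : V) :
  locally_constant_off E h -> 0 <= al -> al < be ->
  (forall v, ~ E v -> ~ E (v + t) -> al * (h v)%:R + be * (h (v + t))%:R = k) ->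
  forall v, ~ E v -> (al + be) * (h v)%:R = k.
Proof.
move=> hE al0 albe rel; have [_ _ hl] := hE.
have next v s : ~ E v -> exists w, [/\ ~ E w, h w = h v & ~ E (w + s)].
  move=> Ev; have [w [Ew hw] Ews] :=
    near_shift_generic hE s (filterI (near_generic hE Ev) (hl _ Ev)).
  by exists w.
(* Induction on a strict bound for the integer distance between [h v] and [h w]; [v] enters only
   through its value [h v]. *)
have main n v w : ~ E w -> al * (h v)%:R + be * (h w)%:R = k ->
    (absz ((h v)%:Z - (h w)%:Z) < n)%N -> (al + be) * (h w)%:R = k.
  elim: n v w => // n IH v w Ew vw vwn.
  have [w0 [Ew0 hw0 Ew1]] := next w t Ew.
  have := rel _ Ew0 Ew1; rewrite hw0; set w' := w0 + t => ww'.
  have [hvw|hvw] := eqVneq (h v) (h w); first by rewrite -vw hvw mulrDl.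
  (* Subtracting consecutive relations shows that the distance shrinks by the factor
     [al / be < 1]. *)
  have hd : al * ((h v)%:R - (h w)%:R) = - (be * ((h w)%:R - (h w')%:R)).
    by move: vw ww'; lra.
  have be0 : 0 < be by exact: le_lt_trans albe.
  have dlt : `|(h w)%:R - (h w')%:R| < `|(h v)%:R - (h w)%:R| :> R.
    rewrite -(ltr_pM2l be0) -[X in X * `|_ - (h w')%:R|](gtr0_norm be0) -normrM.
    rewrite -normrN -hd normrM ger0_norm// ltr_pM2r// normr_gt0 subr_eq0.
    by rewrite eqr_nat.
  have absE x y : (absz ((h x)%:Z - (h y)%:Z))%:R = `|(h x)%:R - (h y)%:R| :> R.
    by rewrite natr_absz intr_norm intrD mulrNz.
  have := IH w w' Ew1 ww'; rewrite -(ltr_nat R) absE => IHw.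
  have w'k : (al + be) * (h w')%:R = k.
    apply: IHw; apply: lt_le_trans dlt _.
    by rewrite -absE ler_nat -ltnS.
  (* Going back from [w'] to [w]: for nonzero [al] the relation between them forces equal values,
     and for [al = 0] the relation between [v] and [w] already concerns [h w] alone. *)
  have [a0|a0] := eqVneq al 0; first by rewrite -vw a0; ring.
  have -> : h w = h w'; last by [].
  apply/eqP; rewrite -(eqr_nat R); apply/eqP/(mulfI a0).
  by move: w'k ww'; lra.
move=> v Ev; have [w [Ew <- Ewt]] := next v (- t) Ev.
apply: (main _ (w - t) w Ew _ (ltnSn _)).
by have := rel _ Ewt; rewrite subrK => ->.
Qed.

Section TileEquation.
Context {R : realType} {d : nat}.
Variables (B : 'M[R]_d) (P : set 'rV[R]_d) (Lam : multiset 'rV[R]_d).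
Variables (a b : 'rV[R]_d) (k : nat).
Hypotheses (uB : B \in unitmx) (cP : compact P).
Local Notation M := [set lattice_point B z | z in setT].
Hypothesis supp : multiset_support Lam `<=` translate M a `|` translate M b.
Hypothesis tile : k_tiles k P Lam.

Definition weight1 (z : 'rV[int]_d) : R := (Lam (lattice_point B z + a))%:R.

(* The two translates of the lattice may coincide, in which case the points are
   only counted in [weight1]. *)
Definition weight2 (z : 'rV[int]_d) : R :=
  if lattice_point B z + b \in translate M a then 0
  else (Lam (lattice_point B z + b))%:R.

Lemma weight1_ge0 z : 0 <= weight1 z.
Proof. by []. Qed.

Lemma weight2_ge0 z : 0 <= weight2 z.
Proof. by rewrite /weight2; case: ifP. Qed.

(** The sum is split into [translate M a] and its complement; on the complement only [translate M b]
    carries multiplicity. *)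
Lemma tile_equation v : ~ walls B P (v - a) -> ~ walls B P (v - b) ->
  (\esum_(z in hits B P (v - a)) (weight1 z)%:E +
   \esum_(z in hits B P (v - b)) (weight2 z)%:E = k%:R%:E)%E.
Proof.
move=> va vb; rewrite -(tile (v := v)); last first.
  move=> [p bp [l /supp[] [m [z _ <-] <-] plv]].
    by apply: va; apply/wallsP; exists z; rewrite -plv addrA addrK addrK.
  by apply: vb; apply/wallsP; exists z; rewrite -plv addrA addrK addrK.
rewrite [RHS](esumID (translate M a)); last by move=> l _; rewrite lee_fin mulr_ge0.
rewrite !setTI esum_translate_lattice// -(esum_hits _ _ _ _ weight1_ge0); congr (_ + _)%E.
rewrite -(esum_hits _ _ _ _ weight2_ge0).
rewrite -(esum_translate_lattice uB b (fun l =>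
  ((if l \in translate M a then 0 else (Lam l)%:R) * \1_(translate P l) v)%:E)).
rewrite esum_mkcond [RHS]esum_mkcond; apply: eq_esum => l _.
rewrite in_setC; have [la|la] := boolP (l \in translate M a).
  by rewrite mul0r; case: ifP.
case: ifPn => // lb; have -> : Lam l = 0%N; last by rewrite mul0r.
apply/eqP; rewrite -leqn0 leqNgt; apply/negP => /supp[]/mem_set.
  by apply/negP.
by apply/negP.
Qed.

Local Notation E := (walls B P).
Local Notation h := (hit_count B P).

Lemma walls_shift v z : walls B P (v + lattice_point B z) <-> walls B P v.
Proof.
rewrite !wallsP; split=> -[w]; last first.
  by exists (w + z); rewrite lattice_pointD opprD addrACA addrN addr0.
by exists (w - z); rewrite lattice_pointD lattice_pointN opprB addrA.
Qed.

(** This is the tiling identity at [v + lattice_point B n]; the whole family in [n] is what the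
    averaging consumes. *)
Lemma tile_equation_shift v n : ~ E (v - a) -> ~ E (v - b) ->
  (\esum_(z in hits B P (v - a)) (weight1 (z + n))%:E +
   \esum_(z in hits B P (v - b)) (weight2 (z + n))%:E = k%:R%:E)%E.
Proof.
move=> va vb.
rewrite -(esum_hits_shift B P (v - a) n (fun z => (weight1 z)%:E)).
rewrite -(esum_hits_shift B P (v - b) n (fun z => (weight2 z)%:E)).
have sh c : v - c + lattice_point B n = v + lattice_point B n - c by rewrite addrAC.
by rewrite !sh tile_equation// -sh walls_shift.
Qed.

Lemma hit_count_locally_constant : locally_constant_off E h.
Proof.
have [oE dE hE] := walls_locally_constant uB cP; split=> // v /hE.
by apply: filterS => w; rewrite /hit_count => ->.
Qed.

Hypothesis k0 : (0 < k)%N.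

(** If both counts vanished, the lower averaging bound over the one-point box would read
    [k <= 0]. *)
Lemma hit_count_gt0 v : ~ E (v - a) -> ~ E (v - b) -> (0 < h (v - a) + h (v - b))%N.
Proof.
move=> va vb; rewrite lt0n addn_eq0; apply/negP => /andP[/eqP ha /eqP hb].
have [||J bnd] := average_bounds uB cP weight1_ge0 weight2_ge0
  (k := k%:R) (u := v - a) (v := v - b).
- by [].
- by move=> n; exact: tile_equation_shift.
have [_] := bnd 0%N; rewrite ha hb !mul0r addr0 box_sum1 leNgt => /negP; apply.
by rewrite mulr_gt0 ?ltr0n// exprn_gt0.
Qed.

Lemma hit_count_weights :
  (forall v w, ~ E v -> ~ E w -> h v = h w) \/
  exists al be : R, [/\ 0 <= al, 0 <= be & forall v, ~ E v -> ~ E (v + (a - b)) ->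
    al * (h v)%:R + be * (h (v + (a - b)))%:R = k%:R].
Proof.
pose Q (x y : R) := exists v, [/\ ~ E v, ~ E (v + (a - b)), x = (h v)%:R &
  y = (h (v + (a - b)))%:R].
pose C N : R := @box_sum R d (fun=> 1) N.
have C0 N : 0 < C N by rewrite /C box_sum1 exprn_gt0// ltr0n.
have := @limit_weights R (fun N => box_sum weight1 N / C N)
  (fun N => box_sum weight2 N / C N) k%:R Q.
case=> [|N|N|x y|same|[al [be [al0 be0 albe]]]].
- by rewrite ltr0n.
- by rewrite divr_ge0 ?box_sum_ge0// ltW.
- by rewrite divr_ge0 ?box_sum_ge0// ?ltW// => z; exact: weight2_ge0.
- move=> [v [Ev Evt -> ->]].
  apply: (average_cvg uB cP weight1_ge0 weight2_ge0) => // n.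
  have := @tile_equation_shift (v + a) n; rewrite addrK -addrA; exact.
(* Both points are moved slightly so that their translates by [a - b] are generic and their pairs of
   counts satisfy [Q]. *)
- left=> v w Ev Ew; have hl := hit_count_locally_constant; have [_ _ lc] := hl.
  have [v' [Ev' <-] Evt] :=
    near_shift_generic hl (a - b) (filterI (near_generic hl Ev) (lc _ Ev)).
  have [w' [Ew' <-] Ewt] :=
    near_shift_generic hl (a - b) (filterI (near_generic hl Ew) (lc _ Ew)).
  have [||/eqP + _] := same (h v')%:R (h (v' + (a - b)))%:R (h w')%:R (h (w' + (a - b)))%:R.
  + by exists v'.
  + by exists w'.
  + by rewrite eqr_nat => /eqP.
- right; exists al, be; split=> // v Ev Evt.
  by rewrite mulrC [be * _]mulrC; apply: albe; exists v.
Qed.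

End TileEquation.

(** * Shifts that complement the count *)

Section Flip.
Context {R : realType} {d : nat}.
Variables (B : 'M[R]_d) (P : set 'rV[R]_d).
Hypotheses (uB : B \in unitmx) (cP : compact P).
Notation E := (walls B P).
(** Counts are read in [R], where [c - x] is not truncated and [c] can be any real number. *)
Notation count := (fun v => (hit_count B P v)%:R : R).

Let locE : locally_constant_off E count.
Proof.
have [oE dE hE] := hit_count_locally_constant uB cP; split=> // v /hE.
by apply: filterS => w ->.
Qed.

(* Each coset of the lattice of [B] in the refined one is paired by the shift
   with a coset whose count is complementary. *)
Lemma flip_tiles (c : R) (t : 'rV[R]_d) (n : nat) (z : 'rV[int]_d) :
  0 < c -> shift_acts E count (fun x => c - x) t -> t *+ n.+1 = lattice_point B z ->
  exists2 L : set 'rV[R]_d, lattice L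
    & exists2 m : nat, (0 < m)%N & k_tiles m P (multiset_of_set L).
Proof.
move=> c0 flip tz; pose B' := n.+1%:R^-1 *: B.
have uB' : B' \in unitmx := refine_unitmx uB.
have tE : t = lattice_point B' z.
  rewrite /lattice_point -scalemxAr -[_ *m B]/(lattice_point B z) -tz.
  by rewrite -[t *+ _]scaler_nat scalerA mulVf ?scale1r// pnatr_eq0.
have walls_sub v : ~ walls B' P v -> ~ E v.
  move=> Ev /wallsP[w bw]; apply: Ev; apply/wallsP; exists (n.+1%:Z *: w).
  by rewrite lattice_point_refine.
pose N : R := #|{: 'rV['I_n.+1]_d}|%:R.
(* As [t] lies in the refined lattice, the refined count is the same at [v] and [v + t]; adding the
   two gives [c] for each of the [N] residues. *)
have countE v : ~ walls B' P v -> 2 * (hit_count B' P v)%:R = N * c.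
  move=> Ev; have <- : (hit_count B' P v)%:R + (hit_count B' P (v + t))%:R =
      2 * (hit_count B' P v)%:R :> R.
    by rewrite tE hit_count_shift// -mulr2n mulr_natl.
  rewrite !hit_count_refine// !natr_sum -big_split /= /N -sum1_card natr_sum mulr_suml.
  apply: eq_bigr => r _; rewrite mul1r (addrAC v) flip ?subrKC//.
  - by apply: walls_sub; rewrite -lattice_pointN walls_shift.
  - by apply: walls_sub; rewrite -lattice_pointN tE !walls_shift.
have [_ dE _] := walls_locally_constant uB' cP.
have [|v0 [_ Ev0]] := dE setT _ openT; first by exists 0.
exists [set lattice_point B' z | z in setT]; first by exists B'.
exists (hit_count B' P v0).
  rewrite -(ltr0n R) -(pmulr_rgt0 _ (ltr0Sn R 1)) countE//.
  by rewrite mulr_gt0// ltr0n; apply/card_gt0P; exists 0.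
apply: k_tiles_lattice => // v Ev; apply/eqP; rewrite -(eqr_nat R); apply/eqP.
have two : 2 != 0 :> R by [].
by apply: (mulfI two); rewrite !countE.
Qed.

(* The period [t + t] of [count] is a rational point of the lattice up to a
   vector [v] whose whole line consists of periods; removing a suitable multiple
   of [v] from [t] makes [t] rational. *)
Lemma flip_rational (c : R) (t : 'rV[R]_d) :
  shift_acts E count (fun x => c - x) t ->
  exists (s : 'rV[R]_d) (n : nat) (z : 'rV[int]_d),
    shift_acts E count (fun x => c - x) s /\ s *+ n.+1 = lattice_point B z.
Proof.
move=> flip; pose H := shift_acts E count id.
have HB x y : H x -> H y -> H (x - y).
  move=> Hx /(shift_acts_sym (psi := id) (fun=> erefl)) Hy.
  exact: (shift_acts_comp locE Hx Hy).
have Htt : H (t + t).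
  by move=> v Ev Evt; rewrite (shift_acts_comp locE flip flip)//= subKr.
have HM z : H (lattice_point B z).
  by move=> v _ _; rewrite hit_count_shift.
have [n [z [v [n0 tz Hv]]]] :=
  closed_subgroup_multiple (shift_acts_closed locE (phi := id))
    (@shift_acts0 _ _ _ _ _) HB uB HM Htt.
(* From [(t + t) *+ n] equal to a lattice point plus [v], the vector [t] needs the correction
   [v / (2 n)]; the predecessor matches the [n.+1] of the conclusion. *)
exists (t - (n + n)%:R^-1 *: v), (n + n).-1, z; split.
  have Hw : H (- ((n + n)%:R^-1 *: v)) by rewrite -scaleNr; exact: Hv.
  exact: (shift_acts_comp locE flip Hw).
rewrite prednK ?addn_gt0 ?n0// mulrnBl mulrnDr -mulrnDl tz -[_ *: v *+ _]scaler_nat scalerA.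
by rewrite mulfV ?scale1r ?addrK// pnatr_eq0 addn_eq0 andbb -lt0n.
Qed.

End Flip.

Theorem theorem1p4 (R : realType) (d k : nat) (P : set 'rV[R]_d)
    (Lam : multiset 'rV[R]_d) (hk : (0 < k)%N) (hP : convex_polytope P)
    (hLam : discrete_multiset Lam) (htile : k_tiles k P Lam)
    (hunion : exists (M : set 'rV[R]_d) (a b : 'rV[R]_d),
       lattice M /\
       multiset_support Lam `<=` translate M a `|` translate M b) :
  exists2 L : set 'rV[R]_d, lattice L
    & exists2 m : nat, (0 < m)%N & k_tiles m P (multiset_of_set L).
Proof.
have cP := convex_polytope_compact hP.
have [_ [a [b [[B uB ->] supp]]]] := hunion.
have loc := hit_count_locally_constant uB cP; have [_ dE lc] := loc.
have const_case : (forall v w, ~ walls B P v -> ~ walls B P w ->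
    hit_count B P v = hit_count B P w) -> exists2 L : set 'rV[R]_d, lattice L
    & exists2 m : nat, (0 < m)%N & k_tiles m P (multiset_of_set L).
  move=> same.
  have [|v0 [_ Ev0]] := dE setT _ openT; first by exists 0.
  have [v [Ev _] Evt] :=
    near_shift_generic loc (a - b) (filterI (near_generic loc Ev0) (lc _ Ev0)).
  have c0 : (0 < hit_count B P v)%N.
    have := hit_count_gt0 uB cP supp htile hk (v := v + a).
    rewrite addrK -addrA => /(_ Ev Evt).
    by rewrite (same _ _ Evt Ev) addnn double_gt0.
  (* A constant count is complementary to itself, with [c] twice its value and the zero shift; the
     lattice of [B] is then not refined. *)
  apply: (@flip_tiles _ _ B P uB cP (2 * (hit_count B P v)%:R) 0 0 0).
  - by rewrite mulr_gt0// ltr0n.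
  - move=> w Ew _; rewrite addr0 (same _ _ Ew Ev); ring.
  - by rewrite mul0rn lattice_point0.
have [same|[al [be [al0 be0 rel]]]] := hit_count_weights uB cP supp htile hk.
  exact: const_case.
have same_of (s : R) : 0 < s ->
    (forall v, ~ walls B P v -> s * (hit_count B P v)%:R = k%:R) ->
    exists2 L : set 'rV[R]_d, lattice L
    & exists2 m : nat, (0 < m)%N & k_tiles m P (multiset_of_set L).
  move=> s0 sk; apply: const_case => v w Ev Ew; apply/eqP; rewrite -(eqr_nat R).
  by apply/eqP; apply: (mulfI (lt0r_neq0 s0)); rewrite !sk.
have [albe|beal|albe] := ltgtP al be.
- apply: (same_of (al + be)); first by rewrite ltr_wpDl// (le_lt_trans al0).
  exact: contracting_shift loc al0 albe rel.
- apply: (same_of (be + al)); first by rewrite ltr_wpDl// (le_lt_trans be0).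
  (* Reversing the shift exchanges the two weights, so the larger one again multiplies the shifted
     count. *)
  apply: (contracting_shift loc be0 beal (t := - (a - b))) => v Ev Evt.
  by rewrite addrC -{2}(subrK (a - b) v) rel// subrK.
(* Two zero weights would give [k = 0]; positivity allows division by [al], so that counts at [v]
   and [v + (a - b)] add up to [k / al]. *)
- have al_gt0 : 0 < al.
    rewrite lt_neqAle al0 andbT eq_sym; apply/eqP => al_eq0.
    have [|v0 [_ Ev0]] := dE setT _ openT; first by exists 0.
    have [v [Ev _] Evt] :=
      near_shift_generic loc (a - b) (filterI (near_generic loc Ev0) (lc _ Ev0)).
    have := rel _ Ev Evt; rewrite -albe al_eq0 !mul0r addr0 => /esym/eqP.
    by rewrite pnatr_eq0 -leqn0 leqNgt hk.
  have [|s [n [z [flip sz]]]] := @flip_rational _ _ B P uB cP (k%:R / al) (a - b).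
    move=> v Ev Evt; rewrite -(rel _ Ev Evt) -albe.
    by field; rewrite gt_eqF.
  by apply: flip_tiles flip sz => //; rewrite divr_gt0// ltr0n.
Qed.
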